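(* Let $\rho$ be a density matrix on $\mathbb{C}^2$ and let $A,B$ be Hermitian $2\times 2$ complex matrices. Then $$V_\rho(A)\,V_\rho(B)=\frac14\bigl|\langle[A,B]\rangle_\rho\bigr|^2+\mathrm{Cov}_\rho(A,B)^2+\frac{1-P(\rho)}{4}\,\|[A,B]\|^2 .$$
   Context: A density matrix is a positive semidefinite matrix of trace $1$. $\langle X\rangle_\rho:=\mathrm{Tr}(X\rho)$; for Hermitian $X$, $V_\rho(X):=\mathrm{Tr}\bigl((X-\langle X\rangle_\rho\mathbb{I})^2\rho\bigr)$. $[A,B]:=AB-BA$, $\{A,B\}:=AB+BA$, $\mathrm{Cov}_\rho(A,B):=\tfrac12\langle\{A,B\}\rangle_\rho-\langle A\rangle_\rho\langle B\rangle_\rho$. $P(\rho):=\mathrm{Tr}(\rho^2)$ is the purity, and $\|X\|:=\sqrt{\mathrm{Tr}(X^\dagger X)}$ is the Frobenius norm. *)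

(* Defs.v *)
From mathcomp Require Import all_boot all_order all_algebra.
From mathcomp Require Import reals complex.

Set Implicit Arguments.
Unset Strict Implicit.
Unset Printing Implicit Defensive.

Import Order.TTheory GRing.Theory Num.Theory.
Local Open Scope ring_scope.
Local Open Scope sesquilinear_scope.

Section Observables.
Variables (C : numClosedFieldType) (n : nat).
Implicit Types X Y rho : 'M[C]_n.

(* In a numClosedFieldType, [0 <= z] says that z is real and nonnegative. *)
Definition psdmx X : Prop :=
  X \is hermsymmx /\ forall v : 'cV[C]_n, 0 <= (v ^t* *m X *m v) 0 0.

Definition density_matrix rho : Prop := psdmx rho /\ \tr rho = 1.

Definition expectation rho X : C := \tr (X *m rho).

Definition variance rho X : C :=
  let D := X - (expectation rho X)%:M in \tr (D *m D *m rho).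

Definition commutator X Y : 'M[C]_n := X *m Y - Y *m X.

Definition anticommutator X Y : 'M[C]_n := X *m Y + Y *m X.

Definition covariance rho X Y : C :=
  1 / 2 * expectation rho (anticommutator X Y)
  - expectation rho X * expectation rho Y.

Definition purity rho : C := \tr (rho *m rho).

Definition frobenius_norm X : C := sqrtC (\tr (X ^t* *m X)).

End Observables.

(* Main.v *)
(* The commutator of Hermitian matrices is anti-Hermitian, so both
   |<[A,B]>|^2 and ||[A,B]||^2 equal minus the corresponding expressions without
   conjugation. What remains no longer involves conjugation: it is an identity
   between polynomials in the entries of arbitrary 2 x 2 matrices, valid as soon
   as rho has trace 1. *)
Require Import Defs.
From mathcomp Require Import all_boot all_order all_algebra.
From mathcomp Require Import reals complex.
From mathcomp Require Import ring.

Import GRing.Theory Num.Theory.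
Local Open Scope ring_scope.

Section Hermitian.
Local Open Scope sesquilinear_scope.
Variables (C : numClosedFieldType) (n : nat).
Implicit Types X Y rho : 'M[C]_n.

Lemma hermsymmx_trmxC X : X \is hermsymmx -> X ^t* = X.
(* The library predicate carries a sign [(-1) ^+ eps]; the Hermitian case has exponent 0. *)
Proof. by move=> /is_hermitianmxP; rewrite expr0 scale1r => <-. Qed.

Lemma trmxC_commutator X Y : X \is hermsymmx -> Y \is hermsymmx ->
  (commutator X Y) ^t* = - commutator X Y.
Proof.
move=> /hermsymmx_trmxC hX /hermsymmx_trmxC hY.
by rewrite /commutator linearB /= map_mxB !trmx_mul !map_mxM hX hY opprB.
Qed.

Lemma conj_mxtrace X : (\tr X)^* = \tr (X ^t*).
Proof. by rewrite -map_trmx mxtrace_tr trace_map_mx. Qed.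

(** Conjugation reverses the product under the trace, fixes [rho] and negates the commutator;
    cyclicity restores the order, so the expectation is purely imaginary. *)
Lemma normCK_expectation_commutator rho X Y :
    rho \is hermsymmx -> X \is hermsymmx -> Y \is hermsymmx ->
  `|expectation rho (commutator X Y)| ^+ 2
    = - expectation rho (commutator X Y) ^+ 2.
Proof.
move=> hrho hX hY; rewrite normCK /expectation conj_mxtrace trmx_mul map_mxM.
rewrite (hermsymmx_trmxC _ hrho) trmxC_commutator //.
by rewrite mulmxN linearN /= mxtrace_mulC mulrN.
Qed.

Lemma frobenius_norm_commutator X Y : X \is hermsymmx -> Y \is hermsymmx ->
  frobenius_norm (commutator X Y) ^+ 2
    = - \tr (commutator X Y *m commutator X Y).
Proof.
by move=> hX hY; rewrite /frobenius_norm sqrtCK trmxC_commutator // mulNmx linearN.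
Qed.

End Hermitian.

(** In Pauli coordinates, with r the Bloch vector of [rho] and c = a x b for the vectors a, b of
    [A], [B], subtracting the squared covariance leaves c.c - (r x c).(r x c) = (r.c)^2 + (1 - r.r)
    c.c. *)
Lemma variance_mul2 (C : numClosedFieldType) (rho A B : 'M[C]_2) :
  \tr rho = 1 ->
  variance rho A * variance rho B =
    - (1 / 4 * expectation rho (commutator A B) ^+ 2)
    + covariance rho A B ^+ 2
    - (1 - purity rho) / 4 * \tr (commutator A B *m commutator A B).
Proof.
rewrite /variance /covariance /purity /expectation /commutator /anticommutator.
rewrite /mxtrace !big_ord_recl !big_ord0 !addr0.
rewrite !(mxE, big_ord_recl, big_ord0) /= !addr0.
(* The trace condition is solved for the first diagonal entry of [rho]; after substitution the
   remaining entries are independent variables. *)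
by move=> /(canRL (addrK _)) ->; field.
Qed.

Local Open Scope complex_scope.

Theorem theorem2 (R : realType) (rho A B : 'M[R[i]]_2)
  (hrho : density_matrix rho)
  (hA : A \is hermsymmx) (hB : B \is hermsymmx) :
  variance rho A * variance rho B =
    1 / 4 * `|expectation rho (commutator A B)| ^+ 2
    + covariance rho A B ^+ 2
    + (1 - purity rho) / 4 * frobenius_norm (commutator A B) ^+ 2.
Proof.
have [[hherm _] htr] := hrho.
rewrite normCK_expectation_commutator // frobenius_norm_commutator //.
by rewrite !mulrN variance_mul2.
Qed.
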